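(* Let $\xi_1,\xi_2,\dots$ be independent random variables with $P\{\xi_k=m\}=p_{mk}\ge0$ for $m\in\mathbb N$, $\sum_{m}p_{mk}=1$, and let $\xi=\sum_{n=1}^\infty\frac{(-1)^{n-1}}{\xi_1(\xi_1+\xi_2)\cdots(\xi_1+\dots+\xi_n)}$. Then $\xi$ has a discrete distribution if and only if $\prod_{k=1}^\infty\max_m\{p_{mk}\}>0$, and $\xi$ has a continuous distribution if and only if this infinite product equals $0$. Moreover, in the discrete case, choose $g'_k\in\mathbb N$ with $p_{g'_kk}=\max_m\{p_{mk}\}$ for all $k$ and let $x_0=\sum_{n\ge1}\frac{(-1)^{n-1}}{g'_1(g'_1+g'_2)\cdots(g'_1+\dots+g'_n)}$; then the set of atoms of the distribution of $\xi$ consists exactly of those $x\in[0,1]$ whose $\bar O^1$-symbols $g_k(x)$ differ from $g'_k$ for only finitely many $k$, each such differing symbol satisfying $p_{g_k(x)k}>0$.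
   Context: Every irrational $x\in(0,1)$ has a unique expansion $x=\sum_{n\ge1}\frac{(-1)^{n-1}}{g_1(g_1+g_2)\cdots(g_1+\dots+g_n)}$ with all $g_n\in\mathbb N$; $g_n=g_n(x)$ is the $n$-th $\bar O^1$-symbol of $x$. Thus $\xi$ is the random number whose $\bar O^1$-symbols are the independent random variables $\xi_k$. *)

(* Defs.v *)
(* MathComp-Analysis. *)
From HB Require Import structures.
From mathcomp Require Import all_boot all_order all_algebra.
From mathcomp Require Import finmap.
From mathcomp Require Import all_classical all_reals all_analysis.
Import Order.TTheory GRing.Theory Num.Theory.
Import numFieldNormedType.Exports.

Set Implicit Arguments.
Unset Strict Implicit.
Unset Printing Implicit Defensive.

Local Open Scope classical_set_scope.
Local Open Scope ring_scope.

(* Sequences indexed by n >= 1 are represented by functions on [nat], the index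
   being shifted by one ([g 0] is the first symbol); the values of the symbols
   are not shifted, so symbols are positive elements of [nat]. *)

Section Expansion.
Variable R : realType.

Definition O1_term (g : nat -> nat) (n : nat) : R :=
  (-1) ^+ n / \prod_(i < n.+1) (\sum_(j < i.+1) g j)%N%:R.

(* The series converges whenever all the symbols are positive. *)
Definition O1_sum (g : nat -> nat) : R := limn (series (O1_term g)).

Definition is_O1_expansion (x : R) (g : nat -> nat) : Prop :=
  (forall n, 0 < g n)%N /\ series (O1_term g) @ \oo --> x.

(* The symbols of x are meaningful when x is irrational and in ]0, 1[, where the
   expansion exists and is unique; the null sequence is a default value. *)
Definition O1_symbol (x : R) : nat -> nat :=
  xget (fun=> 0%N) [set g | is_O1_expansion x g].

End Expansion.

Definition mutually_independent d d' (T : measurableType d)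
    (T' : measurableType d') (R : realType) (P : probability T R)
    (X : nat -> {RV P >-> T'}) : Prop :=
  forall (J : {fset nat}) (A : nat -> set T'), (forall j, measurable (A j)) ->
    P (\bigcap_(j in [set` J]) (X j @^-1` A j)) =
    (\prod_(j <- J) P (X j @^-1` A j))%E.

Section Distributions.
Variables (R : realType) (mu : probability R R).

Definition discrete_distribution : Prop :=
  exists2 A : set R, countable A & mu A = 1%E.

Definition atoms : set R := [set x | (0 < mu [set x])%E].

Definition continuous_distribution : Prop := atoms = set0.

End Distributions.

(* [p m k] is p_{mk}; only m > 0 matters. The supremum is a maximum as soon as
   the p_{mk} are nonnegative with a finite positive sum over m. *)
Definition max_prob (R : realType) (p : nat -> nat -> R) (k : nat) : R :=
  sup [set p m k | m in [set m | (0 < m)%N]].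

Definition infinite_product (R : realType) (u : nat -> R) : R :=
  limn (fun n => \prod_(k < n) u k).

(* Main.v *)
(* With q_n = g_1 + ... + g_n the expansion becomes the Pierce expansion
   1/q_1 - 1/(q_1 q_2) + ..., and x = (1 - x')/q_1 where x' is the sum for the
   shifted denominators. Since 1/(q_1 + 1) <= x < 1/q_1, the value x determines
   q_1, hence all symbols, and an infinite descent on numerators shows that x is
   irrational. Hence, up to the null event that some symbol vanishes, {xi = x} is
   the event that xi_k = g_k(x) for all k, whose probability
   prod_k p_{g_k(x) k} is at most prod_k max_m p_{mk}. If the latter product is
   0 there are no atoms. If it is positive, P(xi_k = g'_k for all k >= n) is at
   least the product divided by its n-th partial product, so it tends to 1:
   almost surely the symbols of xi eventually agree with g'. This concentrates
   the distribution on a countable set, and it forces the symbols of any atom to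
   agree eventually with g'. *)
Require Import Defs.
From HB Require Import structures.
From mathcomp Require Import all_boot all_order all_algebra.
From mathcomp Require Import finmap.
From mathcomp Require Import all_classical all_reals all_analysis.
From mathcomp Require Import ring lra.
Import Order.TTheory GRing.Theory Num.Theory.
Import numFieldNormedType.Exports.

Set Implicit Arguments.
Unset Strict Implicit.
Unset Printing Implicit Defensive.

Local Open Scope classical_set_scope.
Local Open Scope ring_scope.

(** * Pierce expansions: convergence, bounds, uniqueness and irrationality *)

Section Pierce.
Context {R : realType}.
Implicit Types (q g : nat -> nat) (n : nat).

Definition pierce_term q n : R := (-1) ^+ n / \prod_(i < n.+1) (q i)%:R.

Definition pierce_sum q : R := limn (series (pierce_term q)).

Definition increasing_denominators q :=
  (0 < q 0%N)%N /\ forall n, (q n < q n.+1)%N.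

Lemma increasing_denominators_shift q :
  increasing_denominators q -> increasing_denominators (q \o S).
Proof. by case=> q0 qS; split=> [|n] /=; [exact: leq_ltn_trans (qS 0%N)|]. Qed.

Lemma pierce_termS q n :
  pierce_term q n.+1 = - (pierce_term (q \o S) n / (q 0%N)%:R).
Proof.
by rewrite /pierce_term big_ord_recl/= exprS invfM mulN1r mulNr; congr (- _); ring.
Qed.

Lemma pierce_seriesS q n : series (pierce_term q) n.+1 =
  (1 - series (pierce_term (q \o S)) n) / (q 0%N)%:R.
Proof.
rewrite /series/= big_nat_recl// mulrBl mulr_suml; congr (_ + _).
  by rewrite /pierce_term big_ord_recl big_ord0 mulr1.
by rewrite -sumrN; apply: eq_bigr => i _; rewrite pierce_termS.
Qed.

Lemma denominators_lower_bound q n :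
  increasing_denominators q -> (n < q n)%N.
Proof. by case=> q0 qS; elim: n => // n ih; exact: leq_trans (qS n). Qed.

(** Since [n < q n], every denominator after the first is at least 2, so the [n]-th term is
    dominated by [2 ^- n]. *)
Lemma is_cvg_pierce q :
  increasing_denominators q -> cvgn (series (pierce_term q)).
Proof.
move=> Iq; apply: normed_cvg.
apply: (@series_le_cvg _ _ (geometric 1 2^-1)) => //; last first.
- by apply: is_cvg_geometric_series; rewrite ger0_norm// invf_lt1// ltr1n.
- move=> n /=; rewrite mul1r normrM normrX normrN1 expr1n mul1r.
  rewrite ger0_norm ?invr_ge0 ?prodr_ge0// exprVn lef_pV2 ?posrE ?exprn_gt0//; last first.
    apply: prodr_gt0 => i _; rewrite ltr0n.
    exact: leq_ltn_trans _ (denominators_lower_bound _ Iq).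
  elim: n q Iq => [|n ih] q Iq.
    by rewrite big_ord_recl big_ord0 mulr1 expr0 ler1n; case: Iq.
  rewrite big_ord_recr exprSr/= ler_pM//; first exact: ih.
  rewrite ler_nat; exact: leq_ltn_trans _ (denominators_lower_bound n.+1 Iq).
- by move=> n /=; rewrite mul1r.
- by move=> n; exact: normr_ge0.
Qed.

Lemma pierce_sum_rec q : increasing_denominators q ->
  pierce_sum q = (1 - pierce_sum (q \o S)) / (q 0%N)%:R.
Proof.
move=> Iq; apply/cvg_lim => //; rewrite -cvg_shiftS.
under eq_cvg do rewrite /= pierce_seriesS.
apply: cvgM; last exact: cvg_cst.
apply: cvgB; first exact: cvg_cst.
exact/is_cvg_pierce/increasing_denominators_shift.
Qed.

(** Induction on [n] for all [q] at once: a partial sum is [(1 - s) / q 0], where [s] is a partial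
    sum for the shifted denominators and lies between 0 and 1. *)
Lemma pierce_series_bounds q n : increasing_denominators q ->
  0 <= series (pierce_term q) n <= (q 0%N)%:R^-1.
Proof.
elim: n q => [|n ih] q Iq; first by rewrite /series/= big_geq// lexx invr_ge0/=.
have /andP[s0 s1] := ih _ (increasing_denominators_shift Iq).
have s2 : series (pierce_term (q \o S)) n <= 1.
  by rewrite (le_trans s1)// invf_le1 ?ltr0n ?ler1n (leq_ltn_trans _ (Iq.2 _)).
rewrite pierce_seriesS mulr_ge0 ?subr_ge0 ?invr_ge0//=.
by rewrite ler_piMl ?invr_ge0// gerBl.
Qed.

Lemma pierce_sum_weak_bounds q : increasing_denominators q ->
  0 <= pierce_sum q <= (q 0%N)%:R^-1.
Proof.
move=> Iq; have cq := is_cvg_pierce Iq.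
by apply/andP; split; [apply: limr_ge|apply: limr_le] => //; near=> n;
  have /andP[] := @pierce_series_bounds q n Iq.
Unshelve. all: by end_near. Qed.

(** The shifted sum is at most [1 / q 1], hence at most [1 / (q 0 + 1)]; the recursion then gives
    the bound because [1 - 1 / (q 0 + 1) = q 0 / (q 0 + 1)]. *)
Lemma pierce_sum_ge q : increasing_denominators q ->
  (q 0%N).+1%:R^-1 <= pierce_sum q.
Proof.
move=> Iq; rewrite pierce_sum_rec//.
have /andP[_ s1] := pierce_sum_weak_bounds (increasing_denominators_shift Iq).
have q0 : 0 < (q 0%N)%:R :> R by rewrite ltr0n; case: Iq.
have q1 : (q 0%N).+1%:R <= (q 1%N)%:R :> R by rewrite ler_nat; case: Iq.
have qS0 : 0 < (q 0%N).+1%:R :> R by rewrite ltr0n.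
have s2 : pierce_sum (q \o S) <= (q 0%N).+1%:R^-1.
  by rewrite (le_trans s1)// lef_pV2// posrE (lt_le_trans qS0).
rewrite ler_pdivlMr//; apply: (@le_trans _ _ (1 - (q 0%N).+1%:R^-1)); last first.
  by rewrite lerD2l lerN2.
have := mulVf (lt0r_neq0 qS0); set v := _^-1.
by rewrite -natr1 mulrDr mulr1; lra.
Qed.

Lemma pierce_sum_gt0 q : increasing_denominators q -> 0 < pierce_sum q.
Proof. by move=> /pierce_sum_ge; apply: lt_le_trans; rewrite invr_gt0. Qed.

Lemma pierce_sum_lt q : increasing_denominators q ->
  pierce_sum q < (q 0%N)%:R^-1.
Proof.
move=> Iq; have tail0 := pierce_sum_gt0 (increasing_denominators_shift Iq).
rewrite pierce_sum_rec// -[ltRHS]div1r ltr_pM2r ?invr_gt0 ?ltr0n; last by case: Iq.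
by rewrite ltrBlDr ltrDl.
Qed.

(** From [1 / (q' 0 + 1) <= pierce_sum q' = pierce_sum q < 1 / q 0]. Exchanging [q] and [q'] gives
    equality of the first denominators. *)
Lemma pierce_sum_floor q q' :
  increasing_denominators q -> increasing_denominators q' ->
  pierce_sum q = pierce_sum q' -> (q 0 <= q' 0)%N.
Proof.
move=> Iq Iq' qq'; rewrite -ltnS -(ltr_nat R).
rewrite -ltf_pV2 ?posrE ?ltr0n//; last by case: Iq.
by rewrite (le_lt_trans (pierce_sum_ge Iq'))// -qq' pierce_sum_lt.
Qed.

(** Once the first denominators agree, the recursion makes the shifted sums equal, and the induction
    continues on them. *)
Lemma pierce_sum_inj q q' :
  increasing_denominators q -> increasing_denominators q' ->
  pierce_sum q = pierce_sum q' -> q =1 q'.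
Proof.
move=> + + + n; elim: n q q' => [|n ih] q q' Iq Iq' qq'.
  by apply/eqP; rewrite eqn_leq !pierce_sum_floor.
apply: (ih (q \o S) (q' \o S)); try exact: increasing_denominators_shift.
have q0 : q 0%N = q' 0%N by apply/eqP; rewrite eqn_leq !pierce_sum_floor.
move: qq'; rewrite (pierce_sum_rec Iq) (pierce_sum_rec Iq') q0 => /mulIf H.
by apply/oppr_inj/(@addrI _ 1)/H; rewrite invr_eq0 pnatr_eq0 -lt0n; case: Iq'.
Qed.

(* Fermat descent: the tails of the expansion of [a / b] are fractions with
   denominator [b] and strictly decreasing positive numerators. *)
Lemma pierce_sum_neq_ratio q (a b : nat) : increasing_denominators q ->
  pierce_sum q <> a%:R / b%:R.
Proof.
elim/ltn_ind: a q => a ih q Iq qab.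
have q0 : 0 < (q 0%N)%:R :> R by rewrite ltr0n; case: Iq.
(* Division by zero yields 0, which the positivity of the sum excludes. *)
have b0 : 0 < b%:R :> R.
  rewrite ltr0n lt0n; apply/eqP => b0; have := pierce_sum_gt0 Iq.
  by rewrite qab b0 invr0 mulr0 ltxx.
have tail : pierce_sum (q \o S) = 1 - (q 0%N)%:R * (a%:R / b%:R).
  by rewrite -qab (pierce_sum_rec Iq) mulrCA mulfV ?gt_eqF// mulr1 opprB addrC subrK.
have tail0 := pierce_sum_gt0 (increasing_denominators_shift Iq).
(* Positivity of the tail ensures that the truncated subtraction [b - q 0 * a] is the true one. *)
have le_qa : (q 0 * a <= b)%N.
  rewrite -(ler_nat R) natrM -[leRHS]mul1r -ler_pdivrMr// -mulrA ltW//.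
  by rewrite -subr_gt0 -tail.
have tailE : pierce_sum (q \o S) = (b - q 0 * a)%N%:R / b%:R.
  by rewrite tail natrB// natrM mulrBl divff ?gt_eqF// mulrA.
apply: (ih _ _ _ (increasing_denominators_shift Iq) tailE).
(* The numerator drops because tail [< 1 / q 1 <= 1 / (q 0 + 1) <= pierce_sum q]. *)
rewrite -(ltr_nat R) -(@ltr_pM2r _ b%:R^-1) ?invr_gt0// -tailE -qab.
apply: lt_le_trans (pierce_sum_ge Iq).
apply: lt_le_trans (pierce_sum_lt (increasing_denominators_shift Iq)) _.
by rewrite lef_pV2 ?posrE ?ltr0n ?ler_nat ?(leq_ltn_trans _ (Iq.2 _))//; exact: Iq.2.
Qed.

Lemma pierce_sum_irrational q : increasing_denominators q ->
  irrational (pierce_sum q).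
Proof.
move=> Iq /rationalP[a [b qab]].
apply: (@pierce_sum_neq_ratio q `|a|%N b Iq).
(* The numerator is an integer; positivity of the sum allows its replacement by its absolute value,
   a natural number. *)
rewrite natr_absz ger0_norm//.
have := pierce_sum_gt0 Iq; rewrite qab leNgt; apply: contraPN => a0.
by apply/negP; rewrite -leNgt mulr_le0_ge0 ?invr_ge0// lerz0 ltW.
Qed.

End Pierce.

(** * Transfer to symbols, the successive differences of the denominators *)

Section O1_expansion.
Context {R : realType}.
Implicit Types g : nat -> nat.

Lemma increasing_O1_denominators g : (forall n, 0 < g n)%N ->
  increasing_denominators (fun i => \sum_(j < i.+1) g j)%N.
Proof.
move=> g0; split=> [|n]; first by rewrite big_ord_recl big_ord0 addn0.
by rewrite [ltnRHS]big_ord_recr/= -addn1 leq_add2l.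
Qed.

Lemma is_O1_expansion_sum g : (forall n, 0 < g n)%N ->
  is_O1_expansion (O1_sum R g) g.
Proof. by move=> g0; split=> //; exact: (is_cvg_pierce (increasing_O1_denominators g0)). Qed.

Lemma O1_expansion_sum (x : R) g : is_O1_expansion x g -> x = O1_sum R g.
Proof. by case=> _ /cvg_lim; rewrite /O1_sum => ->. Qed.

Lemma O1_sum_inj g g' : (forall n, 0 < g n)%N -> (forall n, 0 < g' n)%N ->
  O1_sum R g = O1_sum R g' -> g = g'.
Proof.
move=> g0 g'0 sum_eq.
have gg' := pierce_sum_inj (increasing_O1_denominators g0)
  (increasing_O1_denominators g'0) sum_eq.
apply/funext => n; case: n => [|n].
  by have := gg' 0%N; rewrite !big_ord_recl !big_ord0 !addn0.
have := gg' n.+1; rewrite big_ord_recr [RHS]big_ord_recr/= gg'.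
by move/eqP; rewrite eqn_add2l => /eqP.
Qed.

Lemma O1_symbol_sum g : (forall n, 0 < g n)%N -> O1_symbol (O1_sum R g) = g.
Proof.
move=> g0; apply: xget_unique; first exact: is_O1_expansion_sum.
by move=> h /[dup] [[h0 _]] /O1_expansion_sum /O1_sum_inj ->.
Qed.

Lemma O1_symbolP (x : R) :
  is_O1_expansion x (O1_symbol x) \/ O1_symbol x = (fun=> 0%N).
Proof. by rewrite /O1_symbol; case: xgetP => [g _|]; [left|right]. Qed.

Lemma O1_sum_irrational g : (forall n, 0 < g n)%N -> irrational (O1_sum R g).
Proof. by move=> g0; exact: (pierce_sum_irrational (increasing_O1_denominators g0)). Qed.

Lemma O1_sum_bounds g : (forall n, 0 < g n)%N -> 0 <= O1_sum R g <= 1.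
Proof.
move=> g0; have Iq := increasing_O1_denominators g0.
have /andP[s0 s1] := @pierce_sum_weak_bounds R _ Iq.
by apply/andP; split=> //; rewrite (le_trans s1)// invf_le1 ?ltr0n ?ler1n Iq.1.
Qed.

End O1_expansion.

(** * Two auxiliary facts: enumeration of countable sets, attained maxima *)

Lemma countable_subset_range (T : pointedType) (A : set T) : countable A ->
  exists h : nat -> T, A `<=` range h.
Proof.
move=> /countable_injP[f f_inj].
(* Indices that code no element of [A] are sent to [point]; this covers an empty [A] and is why only
   an inclusion is claimed. *)
exists (fun n => xget point (A `&` f @^-1` [set n])) => x Ax; exists (f x) => //.
apply: xget_unique => // y [Ay fyx].
by apply: f_inj; rewrite ?inE.
Qed.

(** The terms tend to 0 and some term is positive, so all but finitely many lie below that term and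
    a maximum over an initial segment is global. *)
Lemma nneseries1_argmax (R : realType) (u : nat -> R) :
  (forall m, (0 < m)%N -> 0 <= u m) -> (\sum_(1 <= m <oo) (u m)%:E = 1)%E ->
  exists2 m, (0 < m)%N & forall j, (0 < j)%N -> u j <= u m.
Proof.
move=> u0 u1; pose v n := u n.+1.
have v_cvg0 : v @ \oo --> 0.
  apply: cvg_series_cvg_0; apply: nondecreasing_is_cvgn.
    by apply: nondecreasing_series => *; exact: u0.
  exists 1 => _ [n _ <-]; rewrite /series/= -(big_add1 _ _ 0%N n.+1 xpredT u).
  rewrite -lee_fin -sumEFin -u1; apply: nneseries_lim_ge => i i0 _.
  by rewrite lee_fin u0.
have [i vi0] : exists i, 0 < v i.
  apply/not_existsP => v0; have : (\sum_(1 <= m <oo) (u m)%:E = 0)%E.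
    apply: eseries0 => -[//|m] _ _; congr EFin; apply/eqP.
    by rewrite eq_le u0// andbT leNgt; apply/negP/v0.
  by rewrite u1 => -[] /eqP; rewrite oner_eq0.
have [N _ vN] := cvgr_lt _ v_cvg0 _ vi0.
(* The segment reaches [i] as well as [N], so its maximum dominates [v i] and hence every term
   beyond [N]. *)
have [j _ jmax] := @arg_maxP _ _ _ (ord0 : 'I_(maxn N i).+1) xpredT v isT.
exists j.+1 => // -[//|k] _; rewrite -/(v k) -/(v j).
have vij : v i <= v j.
  by have := jmax (@Ordinal (maxn N i).+1 i _) isT; apply; rewrite ltnS leq_maxr.
have [kN|kN] := leqP N k; first by apply: le_trans vij; exact/ltW/vN.
have kM : (k < (maxn N i).+1)%N by rewrite ltnS leq_max (ltnW kN).
exact: (jmax (Ordinal kM)).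
Qed.

(** * Infinite intersections of independent events *)

Section Independence.
Context d d' (T : measurableType d) (T' : measurableType d') (R : realType).
Context (P : probability T R) (X : nat -> {RV P >-> T'}).
Context (X_indep : mutually_independent X).
Context (A : nat -> set T').
Context (mA : forall k, measurable (A k)).

Let mXA k : measurable (X k @^-1` A k).
Proof. exact: measurable_funPTI. Qed.

Lemma independent_prod n :
  P (\bigcap_(k < n) X k @^-1` A k) = (\prod_(k < n) P (X k @^-1` A k))%E.
Proof.
have -> : [set k | (k < n)%N] = [set` fset_set `I_n] by rewrite fset_setK.
rewrite X_indep// -(big_mkord xpredT (fun k => P (X k @^-1` A k))).
apply: perm_big; apply: uniq_perm; rewrite ?fset_uniq ?iota_uniq//.
by move=> k; rewrite in_fset_set// mem_index_iota/=; apply/idP/idP; rewrite inE.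
Qed.

(** Continuity from above along the decreasing finite intersections [F n], whose probabilities are
    the partial products. *)
Lemma independent_cvg (a : nat -> R) :
  (forall k, P (X k @^-1` A k) = (a k)%:E) ->
  \prod_(k < n) a k @[n --> \oo] --> fine (P (\bigcap_k X k @^-1` A k)).
Proof.
move=> aE; pose F n := \bigcap_(k < n) X k @^-1` A k.
have capF : \bigcap_n F n = \bigcap_k X k @^-1` A k.
  apply/seteqP; split=> [t Ft k _|t At n _ k _]; last exact: At.
  exact: (Ft k.+1 Logic.I k (ltnSn k)).
have mF n : measurable (F n) by exact: bigcap_measurableType.
have -> : (fun n => \prod_(k < n) a k) = fine \o (P \o F).
  apply/funext => n /=; rewrite independent_prod.
  by rewrite (eq_bigr (fun k : 'I_n => (a k)%:E)) ?prodEFin// => k _; exact: aE.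
apply: fine_cvg; rewrite fineK; last first.
  by apply: fin_num_measure; exact: bigcap_measurableType.
rewrite -capF; apply: nonincreasing_cvg_mu => //.
- by rewrite (le_lt_trans (probability_le1 _ _)) ?ltry.
- exact: bigcap_measurableType.
- by move=> m n mn; apply/subsetPset => t Ft k /= km; apply: Ft => /=; exact: leq_trans mn.
Qed.

End Independence.

(** * The random symbols, and the null event where one of them vanishes *)

Section RandomSymbols.
Context (R : realType) (d : measure_display) (T : measurableType d).
Context (P : probability T R) (xi_ : nat -> {RV P >-> nat}).
Context (p : nat -> nat -> R) (xi : {RV P >-> R}).
Context (xi_indep : mutually_independent xi_).
Context (p_ge0 : forall m k, (0 < m)%N -> 0 <= p m k).
Context (p_sum : forall k, (\sum_(1 <= m <oo) (p m k)%:E = 1)%E).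
Context (xi_law : forall m k, (0 < m)%N -> P [set t | xi_ k t = m] = (p m k)%:E).
Context (xiE : forall t, xi t = O1_sum R (fun k => xi_ k t)).

Implicit Types (g : nat -> nat) (x : R).

Let M := max_prob p.
Let mu := distribution P xi.

Definition symbols_event (g : nat -> nat) : set T :=
  \bigcap_k xi_ k @^-1` [set g k].

Definition null_symbol_event : set T := \bigcup_k xi_ k @^-1` [set 0%N].

Lemma measurable_symbols_event g : measurable (symbols_event g).
Proof. by apply: bigcap_measurableType => k _; exact: measurable_funPTI. Qed.

Lemma measurable_null_symbol_event : measurable null_symbol_event.
Proof. by apply: bigcup_measurable => k _; exact: measurable_funPTI. Qed.

Lemma measurable_xi_eq x : measurable (xi @^-1` [set x]).
Proof. by apply: measurable_funPTI; exact: measurable_set1. Qed.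

Lemma symbol_prob_le1 m k : (0 < m)%N -> p m k <= 1.
Proof.
move=> m0; rewrite -lee_fin -xi_law//; apply: probability_le1.
exact: (@measurable_funPTI _ _ _ _ (xi_ k) [set m]).
Qed.

(** The fibres of [xi_ k] partition [T], and those over positive values already carry total mass
    1. *)
Lemma null_symbol_prob k : P (xi_ k @^-1` [set 0%N]) = 0%E.
Proof.
have mX m : measurable (xi_ k @^-1` [set m]) by exact: measurable_funPTI.
have cover : \bigcup_m xi_ k @^-1` [set m] = [set: T].
  by apply/seteqP; split=> // t _; exists (xi_ k t).
have : P (\bigcup_m xi_ k @^-1` [set m]) = (\sum_(m <oo) P (xi_ k @^-1` [set m]))%E.
  rewrite measure_semi_bigcup//; first by apply/trivIsetP => i j _ _ ij;
    apply/seteqP; split=> // t [/= -> /eqP]; rewrite (negbTE ij).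
  exact: bigcup_measurable.
rewrite cover probability_setT nneseries_recl//.
rewrite (_ : (\sum_(1 <= m <oo) _)%E = 1%E); last first.
  rewrite eseries_cond -(p_sum k) [RHS]eseries_cond.
  by apply: eq_eseriesr => m m0; exact: xi_law.
rewrite -[P (xi_ k @^-1` [set 0%N])]fineK ?fin_num_measure// -EFinD.
by move=> [] /eqP; rewrite -subr_eq subrr => /eqP <-.
Qed.

Lemma null_symbol_event_prob : P null_symbol_event = 0%E.
Proof.
apply/negligibleP; first exact: measurable_null_symbol_event.
apply: negligible_bigcup => k; apply/negligibleP; first exact: measurable_funPTI.
exact: null_symbol_prob.
Qed.

(** * The maximal probabilities and their infinite product *)

Lemma max_probP k : exists2 m, (0 < m)%N & M k = p m k.
Proof.
have [m m0 mmax] := nneseries1_argmax (p_ge0 ^~ k) (p_sum k).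
exists m => //; apply/eqP; rewrite eq_le; apply/andP; split.
  by apply: ge_sup; [exists (p m k); exists m|move=> _ [j j0 <-]; exact: mmax].
by apply: ub_le_sup; [exists (p m k) => _ [j j0 <-]; exact: mmax|exists m].
Qed.

Lemma le_max_prob m k : (0 < m)%N -> p m k <= M k.
Proof.
move=> m0; have [j j0 jmax] := nneseries1_argmax (p_ge0 ^~ k) (p_sum k).
by apply: ub_le_sup; [exists (p j k) => _ [i i0 <-]; exact: jmax|exists m].
Qed.

Lemma max_prob_bounds k : 0 <= M k <= 1.
Proof.
by have [m m0 ->] := max_probP k; rewrite p_ge0//= symbol_prob_le1.
Qed.

Lemma infinite_product_cvg :
  \prod_(k < n) M k @[n --> \oo] --> infinite_product M.
Proof.
apply: nonincreasing_is_cvgn.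
  apply/nonincreasing_seqP => n; rewrite big_ord_recr/= ler_piMr//.
    by apply: prodr_ge0 => k _; have /andP[] := max_prob_bounds k.
  by have /andP[] := max_prob_bounds n.
exists 0 => _ [n _ <-].
by apply: prodr_ge0 => k _; have /andP[] := max_prob_bounds k.
Qed.

Lemma infinite_product_ge0 : 0 <= infinite_product M.
Proof.
apply: (cvgr_to_ge infinite_product_cvg); near=> n.
by apply: prodr_ge0 => k _; have /andP[] := max_prob_bounds k.
Unshelve. all: by end_near. Qed.

(** All factors lie between 0 and 1, so later partial products are smaller. *)
Lemma infinite_product_le n : infinite_product M <= \prod_(k < n) M k.
Proof.
apply: (cvgr_to_le infinite_product_cvg); exists n => // m /= nm.
rewrite (big_ord_widen m M nm) [leRHS]big_mkcond; apply: ler_prod => k _.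
have /andP[M0 M1] := max_prob_bounds k.
by rewrite M0/=; case: ifP.
Qed.

(** * Probability that [xi] takes a given value *)

Lemma symbols_event_cvg g : (forall k, 0 < g k)%N ->
  \prod_(k < n) p (g k) k @[n --> \oo] --> fine (P (symbols_event g)).
Proof.
move=> g0; apply: (@independent_cvg _ _ _ _ _ _ _ xi_indep (fun k => [set g k])
  _ (fun k => p (g k) k)) => // k; exact: xi_law.
Qed.

Lemma symbols_event_prob_le g : (forall k, 0 < g k)%N ->
  (P (symbols_event g) <= (infinite_product M)%:E)%E.
Proof.
move=> g0; rewrite -[leLHS]fineK ?fin_num_measure//; last exact: measurable_symbols_event.
rewrite lee_fin; apply: ler_cvg_to (symbols_event_cvg g0) infinite_product_cvg _.
by near=> n; apply: ler_prod => k _; rewrite p_ge0//= le_max_prob.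
Unshelve. all: by end_near. Qed.

(** Injectivity of the expansion holds for positive symbols only, so one inequality enlarges
    [symbols_event g] by the null event; the other is a plain inclusion. *)
Lemma xi_eq_prob g : (forall k, 0 < g k)%N ->
  P (xi @^-1` [set O1_sum R g]) = P (symbols_event g).
Proof.
move=> g0; apply/eqP; rewrite eq_le; apply/andP; split.
  rewrite -(measureU0 (measurable_symbols_event g) measurable_null_symbol_event
    null_symbol_event_prob).
  apply: le_measure; rewrite ?inE; [exact: measurable_xi_eq| |].
    exact: measurableU (measurable_symbols_event g) measurable_null_symbol_event.
  move=> t /= xit; have [[k k0]|xi0] := pselect (exists k, xi_ k t = 0%N).
    by right; exists k.
  left => k _ /=; move: xit; rewrite xiE => /O1_sum_inj <- // j.
  by rewrite lt0n; apply/eqP => xi0'; apply: xi0; exists j.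
apply: le_measure; rewrite ?inE; [exact: measurable_symbols_event|exact: measurable_xi_eq|].
move=> t /= tg; rewrite xiE; congr O1_sum; apply/funext => k; exact: tg.
Qed.

(** Otherwise every outcome with value [x] would have a vanishing symbol, and the fibre would be
    null. *)
Lemma xi_eq_prob_gt0 x : (0 < P (xi @^-1` [set x]))%E ->
  exists2 g, (forall k, 0 < g k)%N & x = O1_sum R g.
Proof.
move=> Px; have [[t [xit xi0]]|none] :=
    pselect (exists t, xi t = x /\ forall k, xi_ k t <> 0%N).
  exists (xi_ ^~ t); last by rewrite -xiE.
  by move=> k; rewrite lt0n; apply/eqP/xi0.
suff P0 : P (xi @^-1` [set x]) = 0%E by move: Px; rewrite P0 ltxx.
apply: (subset_measure0 _ measurable_null_symbol_event _ null_symbol_event_prob).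
  exact: measurable_xi_eq.
move=> t xit; apply: contrapT => h; apply: none; exists t; split=> // k xik0.
by apply: h; exists k.
Qed.

Lemma xi_eq_prob_le x :
  (P (xi @^-1` [set x]) <= (infinite_product M)%:E)%E.
Proof.
have [Px0|/xi_eq_prob_gt0[g g0 ->]] := leP (P (xi @^-1` [set x])) 0%E.
  by rewrite (le_trans Px0)// lee_fin infinite_product_ge0.
by rewrite xi_eq_prob// symbols_event_prob_le.
Qed.

(** * Eventual agreement with a most likely sequence; atoms in the discrete case *)

Section MostLikelySymbols.
Context (g' : nat -> nat) (g'P : forall k, (0 < g' k)%N /\ p (g' k) k = M k).

(** Constraining the first [n] symbols by [setT] keeps the event indexed by all [k], so that
    [independent_cvg] applies with factors 1 there. *)
Definition tail_event n : set T :=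
  \bigcap_k xi_ k @^-1` (if (k < n)%N then setT else [set g' k]).

Lemma measurable_tail_event n : measurable (tail_event n).
Proof. by apply: bigcap_measurableType => k _; exact: measurable_funPTI. Qed.

(** For [N >= n] the product of the first [N] maxima splits at [n], and its second part tends to the
    probability of the tail event. The product form avoids dividing by a partial product. *)
Lemma tail_event_prob_ge n :
  infinite_product M <= \prod_(k < n) M k * fine (P (tail_event n)).
Proof.
pose a k := if (k < n)%N then 1 else M k.
have acvg : \prod_(k < N) a k @[N --> \oo] --> fine (P (tail_event n)).
  apply: (@independent_cvg _ _ _ _ _ _ _ xi_indep
    (fun k => if (k < n)%N then setT else [set g' k]) _ a) => // k.
  rewrite /a; case: ifP => kn.
    by rewrite preimage_setT probability_setT.
  by have [g0 <-] := g'P k; exact: xi_law.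
apply: (cvgr_to_ge (cvgM (cvg_cst (\prod_(k < n) M k)) acvg)).
exists n => // N /= nN; apply: le_trans (infinite_product_le N) _.
rewrite (big_ord_widen N M nN) [X in _ <= X * _]big_mkcond -big_split/=.
rewrite [leRHS](eq_bigr (fun k : 'I_N => M k))// => k _; rewrite /a.
by case: ifP => _; rewrite ?mulr1 ?mul1r.
Qed.

Lemma eventually_most_likely_prob : 0 < infinite_product M ->
  P (\bigcup_n tail_event n) = 1%E.
Proof.
move=> M0; have mU : measurable (\bigcup_n tail_event n).
  by apply: bigcup_measurable => n _; exact: measurable_tail_event.
apply/eqP; rewrite eq_le probability_le1//=.
rewrite -[leRHS]fineK ?fin_num_measure// lee_fin.
(* After multiplication by the infinite product, the claim is the limit in [n] of
   [tail_event_prob_ge], with each tail event enlarged to the union. *)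
rewrite -(ler_pM2l M0) mulr1.
apply: (cvgr_to_ge (cvgM infinite_product_cvg
  (cvg_cst (fine (P (\bigcup_n tail_event n)))))).
near=> n; apply: le_trans (tail_event_prob_ge n) _.
apply: ler_wpM2l.
  by apply: prodr_ge0 => k _; have /andP[] := max_prob_bounds k.
apply: fine_le; rewrite ?fin_num_measure//; [exact: measurable_tail_event|].
apply: le_measure; rewrite ?inE//; [exact: measurable_tail_event|].
by move=> t tn; exists n.
Unshelve. all: by end_near. Qed.

Lemma tail_event_symbols n t k : tail_event n t -> (n <= k)%N -> xi_ k t = g' k.
Proof. by move=> /(_ k Logic.I) /= + nk; rewrite ltnNge nk. Qed.

Lemma discrete_of_product_gt0 : 0 < infinite_product M ->
  discrete_distribution mu.
Proof.
move=> M0.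
(* The default of [nth] varies with [k]: [h s] is the sum whose symbols follow the list [s] and then
   [g']. Lists are countable, hence so is the range. *)
pose h (s : seq nat) : R := O1_sum R (fun k => nth (g' k) s k).
have cA : countable (range h).
  exact: sub_countable (card_image_le _ _) (countableP _).
exists (range h) => //.
have mA : measurable (range h).
  by apply: countable_measurable cA => x; exact: measurable_set1.
have mxA : measurable (xi @^-1` range h) by exact: measurable_funPTI.
apply/eqP; rewrite eq_le probability_le1//= -(eventually_most_likely_prob M0).
apply: le_measure; rewrite ?inE//.
  by apply: bigcup_measurable => n _; exact: measurable_tail_event.
move=> t [n _ tn]; exists (mkseq (xi_ ^~ t) n) => //.
rewrite xiE /h; congr O1_sum; apply/funext => k.
have [kn|nk] := ltnP k n; first by rewrite nth_mkseq.
by rewrite nth_default ?size_mkseq// (tail_event_symbols tn).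
Qed.

(** An event of positive probability meets the almost sure event of eventual agreement with [g']; a
    common outcome has symbols [g]. Also, [symbols_event g] lies in each event [xi_ k = g k]. *)
Lemma atom_symbols g : 0 < infinite_product M -> (forall k, 0 < g k)%N ->
  (0 < mu [set O1_sum R g])%E ->
  finite_set [set k | g k <> g' k] /\ forall k, 0 < p (g k) k.
Proof.
move=> M0 g0 mug.
have Pg : (0 < P (symbols_event g))%E by rewrite -xi_eq_prob.
have mg := measurable_symbols_event g.
have mU : measurable (\bigcup_n tail_event n).
  by apply: bigcup_measurable => n _; exact: measurable_tail_event.
split; last first.
  move=> k; rewrite -lte_fin -xi_law//; apply: lt_le_trans Pg _.
  apply: le_measure; rewrite ?inE//.
    exact: (@measurable_funPTI _ _ _ _ (xi_ k) [set g k]).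
  by move=> t; apply.
have [t [tg [n _ tn]]] : symbols_event g `&` \bigcup_n tail_event n !=set0.
  apply/set0P/eqP => disj.
  (* Disjointness would give the union probability above 1. *)
  have : P (symbols_event g `|` \bigcup_n tail_event n) = (P (symbols_event g) + 1)%E.
    by rewrite measureU//; congr (_ + _)%E; exact: eventually_most_likely_prob.
  have := probability_le1 P (measurableU _ _ mg mU) => /[swap] ->.
  by rewrite -[leRHS]add0e leeD2rE// leNgt Pg.
apply: (sub_finite_set _ (finite_II n)) => k /= gk; rewrite ltnNge; apply/negP => nk.
by apply: gk; rewrite -(tail_event_symbols tn nk) (tg k Logic.I).
Qed.

Lemma symbols_atom g : 0 < infinite_product M -> (forall k, 0 < g k)%N ->
  finite_set [set k | g k <> g' k] ->
  (forall k, g k <> g' k -> 0 < p (g k) k) ->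
  (0 < mu [set O1_sum R g])%E.
Proof.
move=> M0 g0 gfin gp; rewrite /mu /distribution/= /pushforward xi_eq_prob//.
rewrite -[ltRHS]fineK ?fin_num_measure//; last exact: measurable_symbols_event.
rewrite lte_fin.
have [n ngg'] : exists n, forall k, (n <= k)%N -> g k = g' k.
  have [n gn] : exists n, [set k | g k <> g' k] `<=` `I_n.
    exists (\max_(k <- fset_set [set k | g k <> g' k]) k.+1)%N => k gk /=.
    apply: (@leq_bigmax_seq _ _ xpredT S) => //; have := gk.
    by rewrite in_fset_set// inE.
  by exists n => k; apply: contraPP => /gn/=; rewrite ltnNge => /negP.
(* A zero factor would annihilate a partial product, which bounds the infinite product from
   above. *)
have Mk_gt0 k : 0 < M k.
  rewrite lt0r; have /andP[-> _] := max_prob_bounds k; rewrite andbT.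
  apply/eqP => Mk; have := infinite_product_le k.+1.
  by rewrite big_ord_recr/= Mk mulr0 leNgt M0.
have pg_gt0 k : 0 < p (g k) k.
  by have [->|/gp//] := pselect (g k = g' k); rewrite (g'P k).2.
(* A generous lower bound: the factors [M k] with [k < n] are kept too, which is harmless since they
   are at most 1. *)
apply: (@lt_le_trans _ _ (\prod_(k < n) p (g k) k * infinite_product M)).
  by rewrite mulr_gt0// prodr_gt0.
apply: (cvgr_to_ge (symbols_event_cvg g0)); exists n => // N /= nN.
apply: (@le_trans _ _ (\prod_(k < n) p (g k) k * \prod_(k < N) M k)).
  by rewrite ler_wpM2l ?infinite_product_le// prodr_ge0// => k _; exact: ltW.
rewrite (big_ord_widen N (fun k => p (g k) k) nN) [X in X * _ <= _]big_mkcond -big_split/=.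
apply: ler_prod => k _; have /andP[Mk0 Mk1] := max_prob_bounds k.
case: ifP => kn; first by rewrite mulr_ge0 ?p_ge0//= ler_piMr// p_ge0.
by rewrite mul1r Mk0/= ngg' ?(g'P k).2// leqNgt kn.
Qed.

End MostLikelySymbols.

(** Every singleton is null by [xi_eq_prob_le], hence so is a countable union of singletons. *)
Lemma distribution_product_eq0 (A : set R) :
  infinite_product M = 0 -> countable A -> mu A = 0%E.
Proof.
move=> M0 cA; have [h Ah] := countable_subset_range cA.
apply/negligibleP.
  by apply: countable_measurable cA => x; exact: measurable_set1.
apply: (@negligibleS _ _ _ _ (\bigcup_n [set h n])).
  by move=> x /Ah[n _ <-]; exists n.
apply: negligible_bigcup => n; apply/negligibleP; first exact: measurable_set1.
by apply/eqP; rewrite -measure_le0; have := xi_eq_prob_le (h n); rewrite M0.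
Qed.

End RandomSymbols.

Theorem theorem9 (R : realType) (d : measure_display) (T : measurableType d)
    (P : probability T R)
    (xi_ : nat -> {RV P >-> nat}) (p : nat -> nat -> R) (xi : {RV P >-> R})
    (xi_indep : mutually_independent xi_)
    (p_ge0 : forall m k, (0 < m)%N -> 0 <= p m k)
    (p_sum : forall k, (\sum_(1 <= m <oo) (p m k)%:E = 1)%E)
    (xi_law : forall m k, (0 < m)%N -> P [set t | xi_ k t = m] = (p m k)%:E)
    (xiE : forall t, xi t = O1_sum R (fun k => xi_ k t)) :
  [/\ discrete_distribution (distribution P xi) <->
        0 < infinite_product (max_prob p),
      continuous_distribution (distribution P xi) <->
        infinite_product (max_prob p) = 0
    & discrete_distribution (distribution P xi) ->
      forall (g' : nat -> nat) (x0 : R),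
        (forall k, (0 < g' k)%N /\ p (g' k) k = max_prob p k) ->
        x0 = O1_sum R g' ->
        atoms (distribution P xi) =
        [set x : R | [/\ 0 <= x <= 1, irrational x,
           finite_set [set k | O1_symbol x k <> g' k]
         & forall k, O1_symbol x k <> g' k -> 0 < p (O1_symbol x k) k]]].
Proof.
set M := max_prob p.
(* The two equivalences come with no most likely sequence, so one is chosen here; the description of
   the atoms later uses the given one. *)
have [g' g'P] : exists g', forall k, (0 < g' k)%N /\ p (g' k) k = M k.
  have max_prob_ex k : exists m, (0 < m)%N /\ p m k = M k.
    by have [m m0 Mk] := max_probP p_ge0 p_sum k; exists m.
  by have [g' g'P] := choice max_prob_ex; exists g'.
have M_ge0 : 0 <= infinite_product M by exact: infinite_product_ge0 xi_law.
have discreteP : discrete_distribution (distribution P xi) <->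
    0 < infinite_product M.
  split; last exact: (discrete_of_product_gt0 xi_indep p_ge0 p_sum xi_law xiE g'P).
  move=> [A cA muA]; rewrite lt0r M_ge0 andbT; apply/eqP => M0.
  have := distribution_product_eq0 xi_indep p_ge0 p_sum xi_law xiE M0 cA.
  by rewrite muA => -[] /eqP; rewrite oner_eq0.
split=> //.
  split=> [noatom|M0].
    apply/eqP; rewrite eq_le M_ge0 andbT leNgt; apply/negP => M0.
    (* If the product is positive, the most likely sequence itself yields an atom. *)
    suff : atoms (distribution P xi) (O1_sum R g') by rewrite noatom.
    apply: (symbols_atom xi_indep p_ge0 p_sum xi_law xiE g'P M0) => //.
    - by move=> k; case: (g'P k).
    - by rewrite (_ : [set k | _] = set0)//; apply/seteqP; split.
  apply/seteqP; split=> // x; rewrite /atoms/=.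
  by rewrite (distribution_product_eq0 xi_indep p_ge0 p_sum xi_law xiE M0) ?ltxx.
move=> /discreteP M0 {}g' x0 {}g'P _; apply/seteqP; split=> x.
  move=> mux; have [g g0 xE] := xi_eq_prob_gt0 p_sum xi_law xiE mux.
  move: mux; rewrite xE => mux.
  have [gfin gp] := atom_symbols xi_indep p_ge0 p_sum xi_law xiE g'P M0 g0 mux.
  rewrite /= O1_symbol_sum//; split=> // [|]; first exact: O1_sum_bounds.
  exact: O1_sum_irrational.
move=> [_ _ gfin gp].
(* If [x] had no expansion, its default null symbols would differ from the positive [g'] at every
   index, contradicting finiteness. *)
have [gx|g0] := O1_symbolP x; last first.
  have : infinite_set [set: nat] by exact: infinite_nat.
  by case; apply: sub_finite_set gfin => k _ /=; rewrite g0 => gk;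
    have [] := g'P k; rewrite -gk.
rewrite /= (O1_expansion_sum gx).
exact: (symbols_atom xi_indep p_ge0 p_sum xi_law xiE g'P M0 gx.1 gfin gp).
Qed.
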